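(* There is a constant $\rho\ge1$, depending only on the dimension $d$ and the shape regularity of the mesh $\mathcal T_h$, such that for all $z\in\mathcal Z$ $$\sum_{E\in\mathcal E_h^o\cup\mathcal E_h^D}\big\|h_E^{-1/2}\big([\![z]\!]-\mathcal P_E^0[\![z]\!]\big)\big\|_{0,E}^2\ \le\ \Big(1-\frac1\rho\Big)\sum_{E\in\mathcal E_h^o\cup\mathcal E_h^D}\big\|h_E^{-1/2}[\![z]\!]\big\|_{0,E}^2 .$$
   Context: $\Omega\subset\mathbb R^d$, $d\in\{2,3\}$, is a polygon/polyhedron, $\partial\Omega=\Gamma_D\cup\Gamma_N$ (either part may be empty). $\mathcal T_h$ is a conforming (no hanging nodes) shape-regular partition of $\Omega$ into simplices $T$ of diameter $h_T$; the shape-regularity constant is a bound on $\max_T h_T/r_T$, $r_T$ the inradius of $T$. $\mathcal E_h^o$ is the set of interior faces ($(d-1)$-dimensional simplices); each boundary face belongs either to the set $\mathcal E_h^D$ of faces on $\Gamma_D$ or to the set $\mathcal E_h^N$ of faces on $\Gamma_N$. $h_E$ is the diameter of the face $E$ and $\|\cdot\|_{0,E}$ the $L^2(E)$ norm. Each interior face has a fixed unit normal, and $T^+$ (resp. $T^-$) is the neighbor for which this normal is outward (resp. inward). On interior faces $\{\!\{w\}\!\}=(w^++w^-)/2$ and $[\![w]\!]=w^+-w^-$ with $w^\pm$ the traces from $T^\pm$; on boundary faces $\{\!\{w\}\!\}=[\![w]\!]=w$. $\mathcal P_E^0w=\frac1{|E|}\int_E w$ is the $L^2(E)$-projection onto constants.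 $V^{DG}$ is the space of functions in $L^2(\Omega)$ that are affine on each $T\in\mathcal T_h$, and $$\mathcal Z=\{z\in V^{DG}:\ \mathcal P_E^0\{\!\{z\}\!\}=0\ \text{ for all }E\in\mathcal E_h^o\cup\mathcal E_h^N\}.$$ *)

(* Defs.v *)
From HB Require Import structures.
From mathcomp Require Import all_boot all_order all_algebra.
From mathcomp Require Import all_classical all_reals all_analysis.
Set Implicit Arguments.
Unset Strict Implicit.
Unset Printing Implicit Defensive.
Import Order.TTheory GRing.Theory Num.Theory.
Import numFieldNormedType.Exports.
Local Open Scope classical_set_scope.
Local Open Scope ring_scope.

(* The library norm on 'rV[R]_d is the sup norm; diameters, inradii and unit
   normals are Euclidean. The two norms induce the same topology. *)
Definition dotr (R : realType) (d : nat) (x y : 'rV[R]_d) : R :=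
  \sum_(i < d) x ord0 i * y ord0 i.

Definition enorm (R : realType) (d : nat) (x : 'rV[R]_d) : R :=
  Num.sqrt (dotr x x).

Definition diam (R : realType) (d : nat) (A : set 'rV[R]_d) : R :=
  sup [set r | exists x y, [/\ A x, A y & r = enorm (x - y)]].

Definition inradius (R : realType) (d : nat) (A : set 'rV[R]_d) : R :=
  sup [set r | 0 <= r /\
    exists c, forall x : 'rV[R]_d, enorm (x - c) <= r -> A x].

Definition frontier (R : realType) (d : nat) (A : set 'rV[R]_d) :
  set 'rV[R]_d := closure A `\` interior A.

(* A simplex is given by the finite set A of (the labels of) its vertices;
   chull pos A is the closed simplex and ohull pos A its relative interior. *)
Definition chull (R : realType) (d : nat) (V : finType) (pos : V -> 'rV[R]_d)
    (A : {set V}) : set 'rV[R]_d :=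
  [set x | exists l : V -> R, [/\ forall v, v \in A -> 0 <= l v,
    \sum_(v in A) l v = 1 & x = \sum_(v in A) l v *: pos v]].

Definition ohull (R : realType) (d : nat) (V : finType) (pos : V -> 'rV[R]_d)
    (A : {set V}) : set 'rV[R]_d :=
  [set x | exists l : V -> R, [/\ forall v, v \in A -> 0 < l v,
    \sum_(v in A) l v = 1 & x = \sum_(v in A) l v *: pos v]].

Definition aff_indep (R : realType) (d : nat) (V : finType)
    (pos : V -> 'rV[R]_d) (A : {set V}) : Prop :=
  forall l : V -> R, \sum_(v in A) l v = 0 ->
    \sum_(v in A) l v *: pos v = 0 -> forall v, v \in A -> l v = 0.

Definition full_simplex (R : realType) (d : nat) (V : finType)
    (pos : V -> 'rV[R]_d) (A : {set V}) : Prop :=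
  #|A| = d.+1 /\ aff_indep pos A.

(* Open polygons (d = 2) and polyhedra (d = 3). *)
Definition polyhedral (R : realType) (d : nat) (Omega : set 'rV[R]_d) : Prop :=
  exists (V : finType) (pos : V -> 'rV[R]_d) (S : {set {set V}}),
    (forall A, A \in S -> full_simplex pos A) /\
    Omega = interior (\bigcup_(A in [set A | A \in S]) chull pos A).

(* No hanging nodes: two closed cells meet exactly in the (possibly empty)
   face spanned by their common vertices. *)
Record mesh (R : realType) (d : nat) := Mesh {
  vertex : finType;
  pos : vertex -> 'rV[R]_d;
  cells : {set {set vertex}};
  pos_inj : injective pos;
  cells_simplex : forall T, T \in cells -> full_simplex pos T;
  cells_conforming : forall T T', T \in cells -> T' \in cells ->
    chull pos T `&` chull pos T' = chull pos (T :&: T')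
}.

Definition mesh_of (R : realType) (d : nat) (Th : mesh R d)
    (Omega : set 'rV[R]_d) : Prop :=
  \bigcup_(T in [set T | T \in cells Th]) chull (@pos R d Th) T
  = closure Omega.

Definition shape_regular (R : realType) (d : nat) (Th : mesh R d)
    (sigma : R) : Prop :=
  forall T, T \in cells Th ->
    diam (chull (@pos R d Th) T) <= sigma * inradius (chull (@pos R d Th) T).

Definition neighbors (R : realType) (d : nat) (Th : mesh R d)
    (E : {set vertex Th}) : {set {set vertex Th}} :=
  [set T in cells Th | E \subset T]%SET.

Definition interior_faces (R : realType) (d : nat) (Th : mesh R d) :
  {set {set vertex Th}} := [set E : {set vertex Th} |
    (#|E| == d) && (1 < #|neighbors E|)%N]%SET.

Definition boundary_faces (R : realType) (d : nat) (Th : mesh R d) :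
  {set {set vertex Th}} := [set E : {set vertex Th} |
    (#|E| == d) && (#|neighbors E| == 1)%N]%SET.

(* Faces on a part Gamma of the boundary. Using the relative interior of the
   face makes this insensitive to which of the two parts contains the points
   of the interface between them. *)
Definition faces_on (R : realType) (d : nat) (Th : mesh R d)
    (Gamma : set 'rV[R]_d) : {set {set vertex Th}} :=
  [set E : {set vertex Th} in boundary_faces Th |
    `[< ohull (@pos R d Th) E `<=` Gamma >]]%SET.

Definition unit_normal (R : realType) (d : nat) (Th : mesh R d)
    (E : {set vertex Th}) (n : 'rV[R]_d) : Prop :=
  enorm n = 1 /\
  forall v w, v \in E -> w \in E -> dotr n (pos v - pos w) = 0.

Definition outward (R : realType) (d : nat) (Th : mesh R d)
    (T E : {set vertex Th}) (n : 'rV[R]_d) : bool :=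
  [forall v in T :\: E, forall w in E, dotr n (pos v - pos w) < 0].

Definition cell_plus (R : realType) (d : nat) (Th : mesh R d)
    (nu : {set vertex Th} -> 'rV[R]_d) (E : {set vertex Th}) :
    {set vertex Th} :=
  odflt finset.set0 [pick T in neighbors E | outward T E (nu E)].

Definition cell_minus (R : realType) (d : nat) (Th : mesh R d)
    (nu : {set vertex Th} -> 'rV[R]_d) (E : {set vertex Th}) :
    {set vertex Th} :=
  odflt finset.set0 [pick T in neighbors E | outward T E (- nu E)].

Definition cell_bnd (R : realType) (d : nat) (Th : mesh R d)
    (E : {set vertex Th}) : {set vertex Th} :=
  odflt finset.set0 [pick T in neighbors E].

(* Elements of V^DG are classes in L^2(Omega) of functions affine on each open
   cell; values on the (null) mesh skeleton are irrelevant, and square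
   integrability is automatic. *)
Definition VDG (R : realType) (d : nat) (Th : mesh R d) :
  set ('rV[R]_d -> R) :=
  [set z | forall T, T \in cells Th -> exists (a : 'rV[R]_d) (c : R),
     forall x, ohull (@pos R d Th) T x -> z x = dotr a x + c].

Definition trace (R : realType) (d : nat) (Th : mesh R d)
    (z : 'rV[R]_d -> R) (T : {set vertex Th}) (x : 'rV[R]_d) : R :=
  lim (z @ within (ohull (@pos R d Th) T) (nbhs x)).

Definition average (R : realType) (d : nat) (Th : mesh R d)
    (nu : {set vertex Th} -> 'rV[R]_d) (z : 'rV[R]_d -> R)
    (E : {set vertex Th}) (x : 'rV[R]_d) : R :=
  if E \in interior_faces Th then
    (trace z (cell_plus nu E) x + trace z (cell_minus nu E) x) / 2
  else trace z (cell_bnd E) x.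

Definition jump (R : realType) (d : nat) (Th : mesh R d)
    (nu : {set vertex Th} -> 'rV[R]_d) (z : 'rV[R]_d -> R)
    (E : {set vertex Th}) (x : 'rV[R]_d) : R :=
  if E \in interior_faces Th then
    trace z (cell_plus nu E) x - trace z (cell_minus nu E) x
  else trace z (cell_bnd E) x.

(* Lebesgue integral, as an iterated integral, over the k-dimensional simplex
   { t | t_i >= 0, t_0 + ... + t_(k-1) <= c }. *)
Fixpoint simplex_integral (R : realType) (k : nat) (c : R) (f : seq R -> R) :
    R :=
  match k with
  | 0 => f [::]
  | k'.+1 => Rintegral (@lebesgue_measure R) `[0, c]
      (fun t => simplex_integral k' (c - t) (fun s => f (t :: s)))
  end.

Definition face_edge (R : realType) (d : nat) (Th : mesh R d)
    (E : {set vertex Th}) (i : nat) : 'rV[R]_d :=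
  let q := [seq pos v | v <- enum E] in q`_i.+1 - q`_0.

Definition face_param (R : realType) (d : nat) (Th : mesh R d)
    (E : {set vertex Th}) (t : seq R) : 'rV[R]_d :=
  [seq pos v | v <- enum E]`_0 + \sum_(i < d.-1) t`_i *: face_edge E i.

Definition face_gram (R : realType) (d : nat) (Th : mesh R d)
    (E : {set vertex Th}) : 'M[R]_d.-1 :=
  \matrix_(i, j) dotr (face_edge E i) (face_edge E j).

(* Integral against the (d-1)-dimensional surface measure of the face E, through
   its affine parametrization by the reference simplex; the result does not
   depend on the enumeration of the vertices of E. *)
Definition face_integral (R : realType) (d : nat) (Th : mesh R d)
    (E : {set vertex Th}) (f : 'rV[R]_d -> R) : R :=
  Num.sqrt (\det (face_gram E)) *
  simplex_integral d.-1 1 (fun t => f (face_param E t)).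

Definition L2norm (R : realType) (d : nat) (Th : mesh R d)
    (E : {set vertex Th}) (f : 'rV[R]_d -> R) : R :=
  Num.sqrt (face_integral E (fun x => f x ^+ 2)).

Definition P0 (R : realType) (d : nat) (Th : mesh R d)
    (E : {set vertex Th}) (f : 'rV[R]_d -> R) : R :=
  (face_integral E (fun=> 1))^-1 * face_integral E f.

Definition face_diam (R : realType) (d : nat) (Th : mesh R d)
    (E : {set vertex Th}) : R := diam (chull (@pos R d Th) E).

Definition Zspace (R : realType) (d : nat) (Th : mesh R d)
    (nu : {set vertex Th} -> 'rV[R]_d) (GammaN : set 'rV[R]_d) :
  set ('rV[R]_d -> R) :=
  [set z | VDG Th z /\ forall E,
     E \in interior_faces Th :|: faces_on Th GammaN ->
     P0 E (average nu z E) = 0].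

(* Main.v *)
Require Import Defs.
From HB Require Import structures.
From mathcomp Require Import all_boot all_order all_algebra.
From mathcomp Require Import all_classical all_reals all_analysis.
From mathcomp Require Import ring lra.
Set Implicit Arguments.
Unset Strict Implicit.
Unset Printing Implicit Defensive.
Import Order.TTheory GRing.Theory Num.Theory.
Import numFieldNormedType.Exports.
Local Open Scope classical_set_scope.
Local Open Scope ring_scope.

(** Since [||f - P0 f||^2 = ||f||^2 - |E| (P0 f)^2] on each face E, it suffices
    to bound the full jump energy by a multiple of the energy of the mean jumps.
    An affine function on a simplex T is determined by its means over the faces
    of T (the Crouzeix-Raviart degrees of freedom). For z in the space Z, the
    mean over an interior face from either side is, up to sign, half the mean
    jump; it is the mean jump on a Dirichlet face and 0 on a Neumann face. So
    the jumps over E are controlled by the mean jumps over the faces of the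
    neighbors of E, and shape regularity makes the weights [|E| / h_E] of all
    faces of one cell comparable. *)

(** All estimates are carried out on vertex values. Exact quadrature on a face turns means, norms
    and the Pythagorean identity into algebra in the numbers [f (pos v)], so integration enters only
    through cubic polynomials on an interval, and traces only as affine functions on closed cells.
    An interior face is merely a set of [d] vertices with more than one neighbor. That it has
    exactly two, on opposite sides, must be extracted from conformity; only then are [cell_plus] and
    [cell_minus] genuine cells that exhaust the neighbors. For the weights, let r be the inradius of
    a cell T. For each face E of T, the root of the Gram determinant lies between r^(d-1) and
    h_E^(d-1), while h_E <= h_T <= sigma r. Hence the weights of two faces of T differ at most by
    the factor sigma^(d-1). *)

(** * Integrals of polynomials over an interval *)

Lemma continuous_horner (R : realType) (p : {poly R}) : continuous (horner p).
Proof.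
elim/poly_ind: p => [|p c IH] x.
- have -> : horner (0 : {poly R}) = cst 0 by apply/funext => t; rewrite horner0.
  exact: cvg_cst.
- have -> : horner (p * 'X + c%:P) = (fun t => p.[t] * t + c).
    by apply/funext => t; rewrite hornerMXaddC.
  by apply: cvgD; [apply: cvgM; [exact: IH|exact: cvg_id] | exact: cvg_cst].
Qed.

Lemma is_derive_horner (R : realType) (p : {poly R}) (x : R) :
  is_derive x 1 (horner p) p^`().[x].
Proof.
elim/poly_ind: p => [|p c IH].
- have -> : horner (0 : {poly R}) = cst 0 by apply/funext => t; rewrite horner0.
  by rewrite deriv0 horner0; exact: is_derive_cst.
- have -> : horner (p * 'X + c%:P) = (horner p * id + cst c).
    by apply/funext => t; rewrite hornerMXaddC.
  apply: is_derive_eq.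
  by rewrite derivMXaddC hornerD hornerMX /GRing.scale /=; ring.
Qed.

Lemma Rintegral_horner (R : realType) (p : {poly R}) (c : R) : 0 <= c ->
  Rintegral (@lebesgue_measure R) `[0, c] (horner p^`()) = p.[c] - p.[0].
Proof.
rewrite le_eqVlt => /predU1P[<-|c0].
  by rewrite set_itv1 Rintegral_set1 subrr.
rewrite /Rintegral (@continuous_FTC2 _ _ (horner p)) //.
- by apply: continuous_subspaceT; exact: continuous_horner.
- split.
  + by move=> x _; have [] := is_derive_horner p x.
  + by apply: cvg_at_right_filter; exact: continuous_horner.
  + by apply: cvg_at_left_filter; exact: continuous_horner.
- by move=> x _; rewrite derive1E; have [_ ->] := is_derive_horner p x.
Qed.

(** Degree three suffices: for [d = 3] the square of an affine function is quadratic, and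
    integrating it over [[0, 1 - t]] raises the degree in [t] by one. The case [c = 0] occurs in
    that inner integral at [t = 1]. *)
Lemma Rintegral_cubic (R : realType) (c k0 k1 k2 k3 : R) : 0 <= c ->
  Rintegral (@lebesgue_measure R) `[0, c]
    (fun t => k0 + k1 * t + k2 * t ^+ 2 + k3 * t ^+ 3) =
  k0 * c + k1 * c ^+ 2 / 2 + k2 * c ^+ 3 / 3 + k3 * c ^+ 4 / 4.
Proof.
move=> c0; pose p : {poly R} :=
  k0 *: 'X + (k1 / 2) *: 'X^2 + (k2 / 3) *: 'X^3 + (k3 / 4) *: 'X^4.
have -> : (fun t => k0 + k1 * t + k2 * t ^+ 2 + k3 * t ^+ 3) = horner p^`().
  apply/funext => t; rewrite /p !(derivD, derivZ, derivX, derivXn).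
  by rewrite !(hornerD, hornerZ, hornerMn, hornerXn, hornerC); field.
rewrite Rintegral_horner // /p !(hornerD, hornerZ, hornerXn, hornerX).
by field.
Qed.

(** * The Euclidean inner product and norm *)

Section Euclidean.
Variables (R : realType) (d : nat).
Implicit Types x y a : 'rV[R]_d.

Lemma dotrC x y : dotr x y = dotr y x.
Proof. by apply: eq_bigr => i _; rewrite mulrC. Qed.

Lemma dotrDr a x y : dotr a (x + y) = dotr a x + dotr a y.
Proof. by rewrite -big_split; apply: eq_bigr => i _; rewrite mxE mulrDr. Qed.

Lemma dotrZr a (k : R) x : dotr a (k *: x) = k * dotr a x.
Proof. by rewrite mulr_sumr; apply: eq_bigr => i _; rewrite mxE mulrCA. Qed.

Lemma dotrNr a x : dotr a (- x) = - dotr a x.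
Proof. by rewrite -scaleN1r dotrZr mulN1r. Qed.

Lemma dotrBr a x y : dotr a (x - y) = dotr a x - dotr a y.
Proof. by rewrite dotrDr dotrNr. Qed.

Lemma dotrNl x a : dotr (- x) a = - dotr x a.
Proof. by rewrite dotrC dotrNr dotrC. Qed.

Lemma dotrDl x y a : dotr (x + y) a = dotr x a + dotr y a.
Proof. by rewrite dotrC dotrDr !(dotrC a). Qed.

Lemma dotrZl (k : R) x a : dotr (k *: x) a = k * dotr x a.
Proof. by rewrite dotrC dotrZr dotrC. Qed.

Lemma dotrBl x y a : dotr (x - y) a = dotr x a - dotr y a.
Proof. by rewrite dotrDl dotrNl. Qed.

Lemma dotr0r a : dotr a 0 = 0.
Proof. by rewrite -(scale0r 0) dotrZr mul0r. Qed.

Lemma dotr_sumr (I : finType) (A : {set I}) (l : I -> R) (p : I -> 'rV[R]_d) a :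
  dotr a (\sum_(i in A) l i *: p i) = \sum_(i in A) l i * dotr a (p i).
Proof.
elim/big_rec2: _ => [|i u v _ IH]; first exact: dotr0r.
by rewrite dotrDr dotrZr IH.
Qed.

Lemma dotr_ge0 x : 0 <= dotr x x.
Proof. by apply: sumr_ge0 => i _; rewrite -expr2 sqr_ge0. Qed.

Lemma dotr_eq0 x : (dotr x x == 0) = (x == 0).
Proof.
apply/idP/eqP => [|->]; last by rewrite dotr0r.
rewrite /dotr psumr_eq0 => [/allP h|i _]; last by rewrite -expr2 sqr_ge0.
apply/rowP => i; rewrite mxE; have := h i (mem_index_enum _).
by rewrite /= mulf_eq0 orbb => /eqP.
Qed.

Lemma enorm_ge0 x : 0 <= enorm x. Proof. exact: sqrtr_ge0. Qed.

Lemma sqr_enorm x : enorm x ^+ 2 = dotr x x.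
Proof. by rewrite sqr_sqrtr // dotr_ge0. Qed.

Lemma enormZ (k : R) x : enorm (k *: x) = `|k| * enorm x.
Proof.
by rewrite /enorm dotrZl dotrZr mulrA -expr2 sqrtrM ?sqr_ge0 // sqrtr_sqr.
Qed.

Lemma enorm_gt0 x : (0 < enorm x) = (x != 0).
Proof. by rewrite sqrtr_gt0 lt_def dotr_eq0 dotr_ge0 andbT. Qed.

Lemma continuous_dotr a : continuous (dotr a).
Proof.
apply: continuous_big => [|i _ x]; first exact: add_continuous.
have := cvgM (cvg_cst (a ord0 i)) (@coord_continuous R 1 d ord0 i x).
exact.
Qed.

End Euclidean.

(** * Barycentric coordinates and traces of affine functions *)

Section Barycentric.
Variables (R : realType) (d : nat) (V : finType) (pos : V -> 'rV[R]_d).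
Implicit Types (A B T : {set V}) (l : V -> R).

Lemma sum_subset (M : nmodType) A B (F : V -> M) : A \subset B ->
  \sum_(v in B) (if v \in A then F v else 0) = \sum_(v in A) F v.
Proof.
move=> /fintype.subsetP sAB; rewrite -big_mkcondr; apply: eq_bigl => v.
by rewrite andbC; case: (boolP (v \in A)) => // /sAB ->.
Qed.

Lemma chullS A B : A \subset B -> chull pos A `<=` chull pos B.
Proof.
move=> sAB x [l [l0 l1 ->]]; exists (fun v => if v \in A then l v else 0).
split=> [v _||].
- by case: ifP => // /l0.
- by rewrite sum_subset.
- rewrite -(sum_subset _ sAB); apply: eq_bigr => v _.
  by case: ifP => // _; rewrite scale0r.
Qed.

Lemma chull_vertex A v : v \in A -> chull pos A (pos v).
Proof.
move=> vA; exists (fun u => (u == v)%:R); split=> [u _||].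
- exact: ler0n.
- rewrite (bigD1 v) //= eqxx big1 ?addr0 // => u /andP[_ /negbTE ->].
  by [].
- rewrite (bigD1 v) //= eqxx scale1r big1 ?addr0 // => u /andP[_ /negbTE ->].
  by rewrite scale0r.
Qed.

Lemma aff_indep_uniq A l l' : aff_indep pos A ->
  \sum_(v in A) l v = \sum_(v in A) l' v ->
  \sum_(v in A) l v *: pos v = \sum_(v in A) l' v *: pos v ->
  forall v, v \in A -> l v = l' v.
Proof.
move=> iA el ep v vA; apply/eqP; rewrite -subr_eq0; apply/eqP.
apply: (iA (fun v => l v - l' v)) => //; first by rewrite sumrB el subrr.
by under eq_bigr do rewrite scalerBl; rewrite sumrB ep subrr.
Qed.

(** The matrix with rows [(1, pos v)] is square because T has [d + 1] vertices. Affine independence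
    makes its rows free, so they span, and [(1, x)] is a combination of them. *)
Lemma barycentric_coordinates T (x : 'rV[R]_d) : full_simplex pos T ->
  exists2 l, \sum_(v in T) l v = 1 & x = \sum_(v in T) l v *: pos v.
Proof.
case=> cT iT.
pose A : 'M[R]_(#|T|, 1 + d) :=
  \matrix_(i < #|T|) row_mx (const_mx 1) (pos (enum_val i)).
pose ext (u : 'rV[R]_#|T|) v :=
  if [pick i : 'I_#|T| | enum_val i == v] is Some i then u ord0 i else 0.
have extE u i : ext u (enum_val i) = u ord0 i.
  rewrite /ext; case: pickP => [j /eqP/enum_val_inj -> //|/(_ i)].
  by rewrite eqxx.
have mulA (u : 'rV[R]_#|T|) : u *m A =
    row_mx (const_mx (\sum_(v in T) ext u v)) (\sum_(v in T) ext u v *: pos v).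
  rewrite mulmx_sum_row (big_enum_val (ext u)).
  rewrite (big_enum_val (fun v => ext u v *: pos v)).
  rewrite [RHS](_ : _ = \sum_(i < #|T|)
    row_mx (const_mx (ext u (enum_val i)))
           (ext u (enum_val i) *: pos (enum_val i))); last first.
    elim/big_rec3: _ => [|i y1 y2 y3 _ <-]; last first.
      by rewrite add_row_mx; congr row_mx; apply/rowP => k; rewrite !mxE.
    by apply/rowP => k; rewrite !mxE; case: splitP => j _; rewrite mxE.
  apply: eq_bigr => i _; rewrite extE rowK scale_row_mx; congr row_mx.
  by apply/rowP => k; rewrite !mxE mulr1.
have fA : row_full A.
  have: row_free A.
    apply: inj_row_free => u; rewrite mulA -[0 in RHS]row_mx0.
    move=> /eq_row_mx[/rowP/(_ ord0) s0 p0].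
    apply/rowP => i; rewrite mxE -extE; apply: iT => //.
      by rewrite !mxE in s0.
    exact: enum_valP.
  by rewrite /row_free /row_full => /eqP ->; rewrite cT.
have /submxP[D] : (row_mx (const_mx 1 : 'rV_1) x <= A)%MS by exact: submx_full.
rewrite mulA => /eq_row_mx[/rowP/(_ ord0)]; rewrite !mxE => s1 ->.
by exists (ext D).
Qed.

(** By barycentric coordinates, [dotr n] equals [c] on the whole space; evaluation at 0 and at [n]
    gives [dotr n n = 0]. *)
Lemma full_simplex_normal_eq0 T (n : 'rV[R]_d) (c : R) : full_simplex pos T ->
  (forall v, v \in T -> dotr n (pos v) = c) -> n = 0.
Proof.
move=> fT hn.
have cst x : dotr n x = c.
  have [l l1 ->] := barycentric_coordinates x fT.
  rewrite dotr_sumr (eq_bigr (fun v => l v * c)); last by move=> v /hn ->.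
  by rewrite -mulr_suml l1 mul1r.
by apply/eqP; rewrite -dotr_eq0 cst -(cst 0) dotr0r.
Qed.

Lemma closure_ohull A : chull pos A `<=` closure (ohull pos A).
Proof.
move=> x [l [l0 l1 xE]] B Bx.
have cA0 : (0 < #|A|)%N.
  apply/card_gt0P; apply: contrapT => h; move: l1; rewrite big_pred0.
    by move/eqP; rewrite eq_sym oner_eq0.
  by move=> v; apply/negbTE/negP => vA; apply: h; exists v.
have cA : 0 < (#|A|%:R : R) by rewrite ltr0n.
pose b := \sum_(v in A) #|A|%:R^-1 *: pos v.
pose g (t : R) := x + t *: (b - x).
have gB : nbhs (0 : R) (g @^-1` B).
  have : g t @[t --> 0] --> g 0.
    apply: cvgD; first exact: cvg_cst.
    by apply: cvgZr_tmp; exact: cvg_id.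
  by apply; rewrite /g scale0r addr0.
have /nbhs_ballP[e /= e0 eB] := gB.
(* The point [g t] lies on the segment from x to the barycenter b. Any [t] in [(0, 1/2]] makes all
   its weights positive, and [t < e] keeps it in the neighborhood B. *)
pose t := Num.min (e / 2) (1 / 2).
have t0 : 0 < t by rewrite lt_min; apply/andP; split; lra.
have t1 : t <= 1 / 2 by rewrite ge_min lexx orbT.
have te : t < e by rewrite gt_min; apply/orP; left; lra.
exists (g t); split; last first.
  by apply: eB; rewrite /ball /= sub0r normrN gtr0_norm.
exists (fun v => (1 - t) * l v + t * #|A|%:R^-1); split=> [v vA||].
- rewrite ltr_wpDl ?mulr_gt0 ?invr_gt0 // mulr_ge0 ?l0 //; lra.
- rewrite big_split /= -!mulr_sumr l1 sumr_const -[X in t * X]mulr_natr mulVf ?gt_eqF //.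
  ring.
- rewrite /g scalerBr addrCA -[X in _ + (X - _)]scale1r -scalerBl {1}xE /b.
  rewrite addrC !scaler_sumr -big_split /=; apply: eq_bigr => v _.
  by rewrite !scalerA scalerDl.
Qed.

(** Only the values on the open simplex are known. By [closure_ohull] the restricted filter is
    proper at every point of the closed simplex, so the limit there is unique and equals that of the
    affine formula. *)
Lemma affine_trace_lim A (z : 'rV[R]_d -> R) (a : 'rV[R]_d) (c : R) :
  (forall x, ohull pos A x -> z x = dotr a x + c) ->
  forall x, chull pos A x ->
    lim (z @ within (ohull pos A) (nbhs x)) = dotr a x + c.
Proof.
move=> hz x /closure_ohull cx.
have PF : ProperFilter (within (ohull pos A) (nbhs x)).
  exact: within_nbhs_proper.
apply: cvg_lim; first exact: norm_hausdorff.
have h : dotr a y + c @[y --> within (ohull pos A) (nbhs x)] --> dotr a x + c.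
  apply: cvg_within_filter; apply: cvgD; last exact: cvg_cst.
  exact: continuous_dotr.
apply: cvg_trans h; apply: near_eq_cvg.
by apply: filterS (withinT _ _) => y /hz ->.
Qed.

End Barycentric.

(** * Cells on the two sides of a face *)

Section Adjacency.
Variables (R : realType) (d : nat) (Th : mesh R d).
Implicit Types (E T : {set vertex Th}) (n : 'rV[R]_d).

Lemma face_opposite T E : T \in cells Th -> E \subset T -> #|E| = d ->
  exists2 v, v \notin E & T = v |: E.
Proof.
move=> Tc sET cE; have [cT _] := cells_simplex Tc.
have /eqP/cards1P[v Tv] : #|T :\: E| = 1%N.
  by rewrite cardsD (finset.setIidPr sET) cT cE subSnn.
exists v; first by have := finset.set11 v; rewrite -Tv inE => /andP[].
by rewrite -Tv finset.setDE finset.setUIl (finset.setUC (~: E)%SET) finset.setUCr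
  finset.setIT; apply/esym/finset.setUidPl.
Qed.

(** T has a single vertex off E, and [dotr n] is constant on the vertices of E, so one inequality
    decides the test. *)
Lemma outwardE T E n v w : v \notin E -> T = v |: E -> w \in E ->
  (forall u1 u2, u1 \in E -> u2 \in E -> dotr n (pos u1 - pos u2) = 0) ->
  outward T E n = (dotr n (pos v - pos w) < 0).
Proof.
move=> vE -> wE nE; apply/forall_inP/idP => [/(_ v)|lt0 u].
  by rewrite !inE eqxx vE => /(_ isT)/forall_inP/(_ w wE).
rewrite !inE => /andP[uE]; rewrite (negbTE uE) orbF => /eqP ->.
apply/forall_inP => w' w'E; move: lt0 (nE _ _ w'E wE).
by rewrite !dotrBr => lt0 /eqP; rewrite subr_eq0 => /eqP ->.
Qed.

(** Otherwise [dotr n] would be constant on all vertices of T, which forces [n = 0] and contradicts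
    [enorm n = 1]. *)
Lemma outwardN T E n : (0 < d)%N -> T \in cells Th -> E \subset T -> #|E| = d ->
  unit_normal E n -> outward T E n || outward T E (- n).
Proof.
move=> d0 Tc sET cE [n1 nE].
have [v vE TE] := face_opposite Tc sET cE.
have /card_gt0P[w wE] : (0 < #|E|)%N by rewrite cE.
have nE' : forall u1 u2, u1 \in E -> u2 \in E ->
    dotr (- n) (pos u1 - pos u2) = 0.
  by move=> u1 u2 h1 h2; rewrite dotrNl nE // oppr0.
rewrite (outwardE vE TE wE nE) (outwardE vE TE wE nE') dotrNl oppr_lt0.
rewrite -neq_lt; apply/eqP => nv.
have n0 : n = 0.
  apply: (full_simplex_normal_eq0 (c := dotr n (pos w)) (cells_simplex Tc)) => u.
  rewrite TE !inE => /orP[/eqP ->|uE].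
    by apply/eqP; rewrite -subr_eq0 -dotrBr nv.
  by apply/eqP; rewrite -subr_eq0 -dotrBr nE.
move: n1; rewrite n0 /enorm dotr0r sqrtr0 => /eqP.
by rewrite eq_sym oner_eq0.
Qed.

(* If both cells lay on the same side of E, moving from the relative interior of
   E a little towards the vertex v' of T' opposite to E would stay in T, so T
   and T' would share a point outside of E. *)
Lemma outward_inj T T' E n : (0 < d)%N -> T \in cells Th -> T' \in cells Th ->
  E \subset T -> E \subset T' -> #|E| = d ->
  (forall u1 u2, u1 \in E -> u2 \in E -> dotr n (pos u1 - pos u2) = 0) ->
  outward T E n -> outward T' E n -> T = T'.
Proof.
move=> d0 Tc T'c sET sET' cE nE oT oT'.
have [v vE TE] := face_opposite Tc sET cE.
have [v' v'E T'E] := face_opposite T'c sET' cE.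
have /card_gt0P[w wE] : (0 < #|E|)%N by rewrite cE.
move: oT oT'; rewrite (outwardE vE TE wE nE) (outwardE v'E T'E wE nE) => nv nv'.
have [vT'|vT'] := boolP (v \in T').
  have [cT _] := cells_simplex Tc; have [cT' _] := cells_simplex T'c.
  apply/eqP; rewrite eqEcard cT cT' leqnn andbT.
  by rewrite TE finset.subUset finset.sub1set vT' sET'.
exfalso.
have [cT iT] := cells_simplex Tc.
have [mu mu1 muv'] := barycentric_coordinates (pos v') (cells_simplex Tc).
have sumT (M : nmodType) (F : vertex Th -> M) :
    \sum_(u in T) F u = F v + \sum_(u in E) F u by rewrite TE big_setU1.
have sumT' (M : nmodType) (F : vertex Th -> M) :
    \sum_(u in T') F u = F v' + \sum_(u in E) F u by rewrite T'E big_setU1.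
(* Pairing with [n] kills the vertices of E, so the coordinate of [pos v'] at [v] is a quotient of
   two negative numbers. *)
have mu0 : 0 < mu v.
  have : dotr n (pos v' - pos w) = mu v * dotr n (pos v - pos w).
    have -> : pos v' - pos w = \sum_(u in T) mu u *: (pos u - pos w).
      under eq_bigr do rewrite scalerBr.
      by rewrite sumrB -muv' -scaler_suml mu1 scale1r.
    rewrite (dotr_sumr _ mu) sumT big1 ?addr0 // => u uE.
    by rewrite nE // mulr0.
  by move=> h; move: nv'; rewrite h nmulr_llt0.
(* [B] dominates every [- mu u], so the coordinates [e * (mu u + B)] of [x] in T are nonnegative.
   [e] normalizes the weights of [x] in T', namely [e] at [v'] and [e * B] at each of the [d]
   vertices of E. *)
pose B := 1 + \sum_u `|mu u|.
have Bmu u : - mu u <= B.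
  apply: (@le_trans _ _ `|mu u|); first by rewrite -normrN ler_norm.
  by rewrite /B (bigD1 u) //= addrCA lerDl addr_ge0 ?sumr_ge0.
have B0 : 0 < B by rewrite ltr_pwDl ?sumr_ge0.
pose e := (1 + d%:R * B)^-1.
have e1 : e * (1 + d%:R * B) = 1.
  by rewrite mulVf // gt_eqF // ltr_pwDl // mulr_ge0 // ltW.
have e0 : 0 < e by rewrite invr_gt0 ltr_pwDl // mulr_ge0 // ltW.
pose x := e *: pos v' + \sum_(u in E) (e * B) *: pos u.
have xT' : chull (@pos R d Th) T' x.
  exists (fun u => if u == v' then e else e * B); split=> [u _||].
  - by case: ifP => _; rewrite ?mulr_ge0 ?ltW.
  - rewrite sumT' eqxx (eq_bigr (fun=> e * B)); last first.
      by move=> u uE; case: eqP => // uv; rewrite -uv uE in v'E.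
    by rewrite sumr_const cE -[RHS]e1 -mulr_natr; ring.
  - rewrite sumT' eqxx; congr (_ + _); apply: eq_bigr => u uE.
    by case: eqP => // uv; rewrite -uv uE in v'E.
pose l u := if u == v then e * mu v else e * mu u + e * B.
have lE u : u \in E -> l u = e * mu u + e * B.
  by move=> uE; rewrite /l; case: eqP => // uv; rewrite -uv uE in vE.
have lv : l v = e * mu v by rewrite /l eqxx.
have l1 : \sum_(u in T) l u = 1.
  rewrite sumT lv (eq_bigr (fun u => e * mu u + e * B)) //.
  rewrite big_split /= sumr_const cE -mulr_sumr addrA -mulrDr -(sumT _ mu) mu1.
  by rewrite -[RHS]e1 -mulr_natr; ring.
have lx : x = \sum_(u in T) l u *: pos u.
  rewrite sumT lv (eq_bigr (fun u => e *: (mu u *: pos u) + (e * B) *: pos u)).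
    rewrite big_split /= -scaler_sumr addrA -scalerA -scalerDr.
    by rewrite -(sumT _ (fun u => mu u *: pos u)) -muv'.
  by move=> u uE; rewrite lE // scalerDl scalerA.
have xT : chull (@pos R d Th) T x.
  exists l; split=> // u _; rewrite /l; case: ifP => _.
    by rewrite mulr_ge0 ?ltW.
  by rewrite -mulrDr mulr_ge0 ?(ltW e0) // -lerBlDl sub0r.
have : chull (@pos R d Th) (T :&: T') x.
  by rewrite -(cells_conforming Tc T'c); split.
case=> k [k0 k1 kx].
have sI : (T :&: T') \subset T by apply: finset.subsetIl.
have vT : v \in T by rewrite TE finset.setU11.
(* In T the point [x] has the positive weight [e * mu v] at [v], whereas its representation on
   [T :&: T'] has weight 0 there. *)
have := @aff_indep_uniq _ _ _ _ _ l (fun u => if u \in T :&: T' then k u else 0) iT.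
move=> /(_ _ _ v vT); rewrite lv inE (negbTE vT') andbF => lv0.
have /eqP : e * mu v = 0.
  apply: lv0; first by rewrite l1 sum_subset.
  rewrite -lx kx -(sum_subset _ sI); apply: eq_bigr => u _.
  by case: ifP => // _; rewrite scale0r.
by rewrite mulf_eq0 !gt_eqF.
Qed.

(** Every neighbor lies on one of the two sides ([outwardN]), and each side holds at most one
    ([outward_inj]). Two distinct neighbors therefore occupy both sides, so neither choice falls
    back to the default empty set. *)
Lemma neighbors_interior (nu : {set vertex Th} -> 'rV[R]_d) E : (0 < d)%N ->
  E \in interior_faces Th -> unit_normal E (nu E) ->
  [/\ cell_plus nu E \in neighbors E, cell_minus nu E \in neighbors E
    & neighbors E \subset [set cell_plus nu E; cell_minus nu E]%SET].
Proof.
move=> d0; rewrite inE => /andP[/eqP cE nb] un.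
have [_ nE] := un.
have nE' : forall u1 u2, u1 \in E -> u2 \in E ->
    dotr (- nu E) (pos u1 - pos u2) = 0.
  by move=> u1 u2 h1 h2; rewrite dotrNl nE // oppr0.
have nbP T : T \in neighbors E -> T \in cells Th /\ E \subset T.
  by rewrite inE => /andP.
have injP n T T' : (forall u1 u2, u1 \in E -> u2 \in E ->
    dotr n (pos u1 - pos u2) = 0) -> T \in neighbors E -> T' \in neighbors E ->
    outward T E n -> outward T' E n -> T = T'.
  by move=> hn /nbP[? ?] /nbP[? ?]; apply: outward_inj.
have orP' T : T \in neighbors E -> outward T E (nu E) || outward T E (- nu E).
  by move=> /nbP[? ?]; apply: outwardN.
have /card_gt1P[T1 [T2 [T1n T2n T12]]] := nb.
have plusP T : T \in neighbors E -> outward T E (nu E) ->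
    cell_plus nu E = T.
  move=> Tn oT; rewrite /cell_plus; case: pickP => [T' /andP[T'n oT']|/(_ T)] /=.
    exact: injP oT' oT.
  by rewrite Tn oT.
have minusP T : T \in neighbors E -> outward T E (- nu E) ->
    cell_minus nu E = T.
  move=> Tn oT; rewrite /cell_minus; case: pickP => [T' /andP[T'n oT']|/(_ T)] /=.
    exact: injP oT' oT.
  by rewrite Tn oT.
have sub : neighbors E \subset [set cell_plus nu E; cell_minus nu E]%SET.
  apply/fintype.subsetP => T Tn; rewrite !inE.
  by case/orP: (orP' T Tn) => [/(plusP T Tn)|/(minusP T Tn)] ->; rewrite eqxx ?orbT.
split=> //.
- case/orP: (orP' T1 T1n) => o1; first by rewrite (plusP T1).
  case/orP: (orP' T2 T2n) => o2; first by rewrite (plusP T2).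
  by move/eqP: T12; case; exact: injP o1 o2.
- case/orP: (orP' T1 T1n) => o1; last by rewrite (minusP T1).
  case/orP: (orP' T2 T2n) => o2; last by rewrite (minusP T2).
  by move/eqP: T12; case; exact: injP o1 o2.
Qed.

Lemma neighbors_boundary E : E \in boundary_faces Th ->
  neighbors E = [set cell_bnd E]%SET.
Proof.
rewrite inE => /andP[_ /cards1P[T nT]]; rewrite /cell_bnd.
case: pickP => [T'|/(_ T)]; rewrite nT inE; last by rewrite eqxx.
by move=> /eqP ->.
Qed.

End Adjacency.

(** * Diameter and inradius of a simplex *)

Section Size.
Variables (R : realType) (d : nat) (V : finType) (pos : V -> 'rV[R]_d).
Implicit Types (A B : {set V}).

(** [diam] is a [sup], so it dominates the distances only once these are known to be bounded. *)
Lemma has_ubound_dist_chull A : has_ubound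
  [set r | exists x y, [/\ chull pos A x, chull pos A y & r = enorm (x - y)]].
Proof.
pose B i := \sum_(v in A) `|pos v ord0 i|.
have coordB x i : chull pos A x -> `|x ord0 i| <= B i.
  move=> [l [l0 l1 ->]]; rewrite summxE.
  apply: le_trans (ler_norm_sum _ _ _) _; apply: ler_sum => v vA.
  rewrite mxE normrM ler_piMl // ger0_norm ?l0 // -l1 (bigD1 v) //= lerDl.
  by apply: sumr_ge0 => u /andP[/l0].
exists (Num.sqrt (\sum_(i < d) (B i + B i) ^+ 2)) => _ [x [y [Ax Ay ->]]].
rewrite /enorm ler_sqrt; last by apply: sumr_ge0 => i _; exact: sqr_ge0.
apply: ler_sum => i _; rewrite -expr2 !mxE -real_normK ?num_real //.
rewrite ler_pXn2r ?nnegrE ?addr_ge0 ?sumr_ge0 //.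
by apply: le_trans (ler_normB _ _) _; apply: lerD; exact: coordB.
Qed.

Lemma enorm_le_diam A x y : chull pos A x -> chull pos A y ->
  enorm (x - y) <= diam (chull pos A).
Proof.
by move=> Ax Ay; apply: ub_le_sup; [exact: has_ubound_dist_chull | exists x, y].
Qed.

Lemma le_diam A B v : v \in A -> A \subset B ->
  diam (chull pos A) <= diam (chull pos B).
Proof.
move=> vA sAB; apply: ge_sup.
  by exists (enorm (pos v - pos v)), (pos v), (pos v); split=> //;
    exact: chull_vertex.
by move=> _ [x [y [Ax Ay ->]]]; apply: enorm_le_diam; apply: chullS sAB _ _.
Qed.

(** A translation by [y], the sum of the [k u *: pos u], raises the barycentric coordinate at [v] by
    1. A ball of radius [r] in the simplex contains its center moved by [r / enorm y] times [y]. As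
    that coordinate stays in [[0, 1]], [r / enorm y <= 1]. *)
Lemma ubound_inradius A (k : V -> R) v : aff_indep pos A -> v \in A -> k v = 1 ->
  \sum_(u in A) k u = 0 ->
  ubound [set r | 0 <= r /\
    exists c, forall x : 'rV[R]_d, enorm (x - c) <= r -> chull pos A x]
  (enorm (\sum_(u in A) k u *: pos u)).
Proof.
move=> iA vA kv k0 r [r0 [c cr]]; set y := \sum_(u in A) _.
have y0 : 0 < enorm y.
  rewrite enorm_gt0; apply/eqP => /(iA _ k0)/(_ _ vA)/eqP.
  by rewrite kv oner_eq0.
have [l [l0 l1 cE]] : chull pos A c.
  by apply: cr; rewrite subrr /enorm dotr0r sqrtr0.
have [m [m0 m1 xE]] : chull pos A (c + (r / enorm y) *: y).
  apply: cr; rewrite addrC addKr enormZ ger0_norm ?divr_ge0 ?enorm_ge0 //.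
  by rewrite divfK ?gt_eqF.
have mv1 : m v <= 1.
  by rewrite -m1 (bigD1 v) //= lerDl sumr_ge0 // => u /andP[/m0].
have : m v = l v + r / enorm y * k v.
  apply: (aff_indep_uniq (l' := fun u => l u + r / enorm y * k u) iA) => //.
    by rewrite big_split /= -mulr_sumr k0 mulr0 addr0 l1.
  rewrite -xE cE scaler_sumr -big_split /=; apply: eq_bigr => u _.
  by rewrite scalerA scalerDl.
rewrite kv mulr1 => mvE; have := l0 v vA; move: mv1; rewrite mvE => h1 h2.
have : r / enorm y <= 1 by lra.
by rewrite ler_pdivrMr // mul1r.
Qed.

Lemma inradius_le A (k : V -> R) v : aff_indep pos A -> v \in A -> k v = 1 ->
  \sum_(u in A) k u = 0 ->
  0 <= inradius (chull pos A) <= enorm (\sum_(u in A) k u *: pos u).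
Proof.
move=> iA vA kv k0; have ub := ubound_inradius iA vA kv k0.
have in0 : [set r | 0 <= r /\
    exists c, forall x : 'rV[R]_d, enorm (x - c) <= r -> chull pos A x] 0.
  split=> //; exists (pos v) => x x0.
  have : ~~ (0 < enorm (x - pos v)) by rewrite -leNgt.
  by rewrite enorm_gt0 negbK subr_eq0 => /eqP ->; exact: chull_vertex.
apply/andP; split; last by apply: ge_sup => //; exists 0.
by apply: ub_le_sup => //; eexists; exact: ub.
Qed.

Lemma sum_deltaZ (A : {set V}) (k : R) v (F : V -> 'rV[R]_d) : v \in A ->
  \sum_(u in A) (k * (u == v)%:R) *: F u = k *: F v.
Proof.
move=> vA; rewrite (bigD1 v) //= eqxx mulr1 big1 ?addr0 // => u.
by move=> /andP[_ /negbTE ->]; rewrite mulr0 scale0r.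
Qed.

Lemma sum_delta (A : {set V}) (k : R) v : v \in A ->
  \sum_(u in A) k * (u == v)%:R = k.
Proof.
move=> vA; rewrite (bigD1 v) //= eqxx mulr1 big1 ?addr0 // => u.
by move=> /andP[_ /negbTE ->]; rewrite mulr0.
Qed.

Lemma inradius_le_edge A v w : aff_indep pos A -> v \in A -> w \in A ->
  v != w -> 0 <= inradius (chull pos A) <= enorm (pos v - pos w).
Proof.
move=> iA vA wA /negbTE vw.
have := @inradius_le A (fun u => 1 * (u == v)%:R + (-1) * (u == w)%:R) v iA vA.
rewrite big_split /= !sum_delta // subrr eqxx vw mulr1 mulr0 addr0.
under eq_bigr do rewrite scalerDl; rewrite big_split /= !sum_deltaZ //.
by rewrite scale1r scaleN1r; apply.
Qed.

(** When [t] is the projection coefficient, the vector on the right is the height of the triangle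
    over its side from [w0] to [w1]. *)
Lemma inradius_le_height A v w1 w0 (t : R) : aff_indep pos A ->
  v \in A -> w1 \in A -> w0 \in A -> v != w1 -> v != w0 ->
  inradius (chull pos A) <= enorm ((pos v - pos w0) - t *: (pos w1 - pos w0)).
Proof.
move=> iA vA w1A w0A /negbTE vw1 /negbTE vw0.
have := @inradius_le A (fun u => 1 * (u == v)%:R + (- t) * (u == w1)%:R
  + (t - 1) * (u == w0)%:R) v iA vA.
rewrite !big_split /= !sum_delta // eqxx vw1 vw0 mulr1 !mulr0 !addr0.
under eq_bigr do rewrite !scalerDl; rewrite !big_split /= !sum_deltaZ //.
have -> : 1 *: pos v + - t *: pos w1 + (t - 1) *: pos w0 =
    pos v - pos w0 - t *: (pos w1 - pos w0).
  by apply/rowP => i; rewrite !mxE; ring.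
by move=> /(_ erefl) h; have /andP[] := h ltac:(ring).
Qed.

End Size.

(** * Surface measure of a face and exact quadrature *)

(** The root of the Gram determinant is the volume of the parallelotope spanned by the edges; the
    face is the fraction [1 / (d-1)!] of it. *)
Definition face_area (R : realType) (d : nat) (Th : mesh R d)
  (E : {set vertex Th}) : R := Num.sqrt (\det (face_gram E)) / (d.-1)`!%:R.

Definition affine_on (R : realType) (d : nat) (A : set 'rV[R]_d)
    (f : 'rV[R]_d -> R) : Prop :=
  exists (a : 'rV[R]_d) (c : R), forall x, A x -> f x = dotr a x + c.

Lemma enum_card2 (V : finType) (E : {set V}) : #|E| = 2 ->
  exists v0 v1, [/\ enum E = [:: v0; v1], v0 \in E, v1 \in E & v1 != v0].
Proof.
move=> cE; have := enum_uniq E; have mE := mem_enum E.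
move: cE mE; rewrite cardE.
case: (enum E) => [|v0 [|v1 []]] //= _ mE; rewrite inE andbT => ne.
exists v0, v1; split=> //; last by rewrite eq_sym.
  by rewrite -mE !inE eqxx.
by rewrite -mE !inE eqxx orbT.
Qed.

Lemma enum_card3 (V : finType) (E : {set V}) : #|E| = 3 ->
  exists v0 v1 v2, [/\ enum E = [:: v0; v1; v2], [/\ v0 \in E, v1 \in E &
    v2 \in E], v1 != v0, v2 != v0 & v2 != v1].
Proof.
move=> cE; have := enum_uniq E; have mE := mem_enum E.
move: cE mE; rewrite cardE.
case: (enum E) => [|v0 [|v1 [|v2 []]]] //= _ mE; rewrite !inE negb_or.
move=> /andP[/andP[n1 n2]]; rewrite andbT => n3.
by exists v0, v1, v2; split; rewrite 1?eq_sym //; split;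
  rewrite -mE !inE eqxx ?orbT.
Qed.

Lemma det_mx22 (K : comNzRingType) (A : 'M[K]_2) :
  \det A = A ord0 ord0 * A ord_max ord_max - A ord0 ord_max * A ord_max ord0.
Proof.
rewrite (expand_det_row _ ord0) !big_ord_recl big_ord0 /cofactor !det_mx11 !mxE.
have -> : lift ord0 ord0 = ord_max :> 'I_2 by apply/val_inj.
have -> : lift ord_max ord0 = ord0 :> 'I_2 by apply/val_inj.
by rewrite /= expr0 expr1 mul1r mulN1r mulrN addr0.
Qed.

(** The squared area of a parallelogram as base times height, by one Gram-Schmidt step. *)
Lemma gram_height (R : realType) (d : nat) (x y : 'rV[R]_d) : 0 < dotr x x ->
  dotr x x * dotr y y - dotr x y * dotr x y =
  (enorm x * enorm (y - (dotr x y / dotr x x) *: x)) ^+ 2.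
Proof.
move=> x0; rewrite exprMn !sqr_enorm !(dotrBl, dotrBr, dotrZl, dotrZr).
by rewrite (dotrC y x); field; rewrite gt_eqF.
Qed.

(** The root is an edge length for [d = 2] and base times height for [d = 3]. Each of these lengths
    is at least the inradius of the cell T, because the vertices of E are vertices of T. The upper
    bound uses that all edges are at most the diameter of E. *)
Lemma sqrt_det_gram_bounds (R : realType) (d : nat) (Th : mesh R d)
    (T E : {set vertex Th}) :
  d = 2%N \/ d = 3%N -> T \in cells Th -> E \subset T -> #|E| = d ->
  inradius (chull (@pos R d Th) T) ^+ d.-1 <= Num.sqrt (\det (face_gram E))
    <= face_diam E ^+ d.-1.
Proof.
move=> hd Tc /fintype.subsetP sET cE; have [_ iT] := cells_simplex Tc.
case: hd => dE; subst d.
- have [v0 [v1 [eE v0E v1E n10]]] := enum_card2 cE.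
  rewrite det_mx11 mxE /face_edge eE /= !expr1 -/(enorm _) /face_diam.
  have /andP[_ ->] := inradius_le_edge iT (sET _ v1E) (sET _ v0E) n10.
  by apply: enorm_le_diam; exact: chull_vertex.
- have [v0 [v1 [v2 [eE [v0E v1E v2E] n10 n20 n21]]]] := enum_card3 cE.
  rewrite det_mx22 !mxE /face_edge eE /= /face_diam.
  set e1 := pos v1 - pos v0; set e2 := pos v2 - pos v0.
  rewrite (dotrC e2 e1).
  have /andP[r0 r1] := inradius_le_edge iT (sET _ v1E) (sET _ v0E) n10.
  have r2 := inradius_le_height (dotr e1 e2 / dotr e1 e1) iT (sET _ v2E)
    (sET _ v1E) (sET _ v0E) n21 n20.
  rewrite -/e1 -/e2 in r1 r2; set r := inradius _ in r0 r1 r2 *.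
  have h1 : enorm e1 <= diam (chull (@pos R 3 Th) E).
    by apply: enorm_le_diam; exact: chull_vertex.
  have h2 : enorm e2 <= diam (chull (@pos R 3 Th) E).
    by apply: enorm_le_diam; exact: chull_vertex.
  set h := diam _ in h1 h2 *.
  have e10 : 0 < dotr e1 e1.
    rewrite lt_def dotr_ge0 andbT dotr_eq0 subr_eq0.
    by apply: contra n10 => /eqP/pos_inj ->.
  have h0 : 0 <= h by apply: le_trans h1; exact: enorm_ge0.
  apply/andP; split.
  + rewrite gram_height // sqrtr_sqr ger0_norm ?mulr_ge0 ?enorm_ge0 // expr2.
    exact: ler_pM.
  + rewrite -[leRHS]ger0_norm ?exprn_ge0 // -sqrtr_sqr ler_sqrt ?sqr_ge0 //.
    rewrite -!sqr_enorm; apply: (@le_trans _ _ ((enorm e1 * enorm e2) ^+ 2)).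
      by rewrite exprMn lerBlDr lerDl -expr2 sqr_ge0.
    by rewrite ler_pXn2r ?nnegrE ?mulr_ge0 ?exprn_ge0 ?enorm_ge0 // expr2 ler_pM
      ?enorm_ge0.
Qed.

Lemma face_param_affine2 (R : realType) (Th : mesh R 2) (E : {set vertex Th})
    (f : 'rV[R]_2 -> R) v0 v1 t : enum E = [:: v0; v1] ->
  affine_on (chull (@pos R 2 Th) E) f -> 0 <= t <= 1 ->
  f (face_param E [:: t]) = f (pos v0) + (f (pos v1) - f (pos v0)) * t.
Proof.
move=> eE [a [c fE]] /andP[t0 t1].
have v0E : v0 \in E by rewrite -mem_enum eE !inE eqxx.
have v1E : v1 \in E by rewrite -mem_enum eE !inE eqxx orbT.
have n10 : v1 != v0.
  by have := enum_uniq E; rewrite eE /= inE andbT eq_sym.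
rewrite (fE (pos v0)); last exact: chull_vertex.
rewrite (fE (pos v1)); last exact: chull_vertex.
rewrite fE /face_param /face_edge eE /= ?big_ord1 /=.
  by rewrite dotrDr dotrZr dotrBr; ring.
exists (fun v => if v == v0 then 1 - t else t); split=> [v _||].
- by case: ifP => _; lra.
- by rewrite -big_enum eE !big_cons big_nil /= eqxx (negbTE n10); ring.
- rewrite -big_enum eE !big_cons big_nil /= eqxx (negbTE n10).
  by apply/rowP => i; rewrite !mxE; ring.
Qed.

Lemma face_param_affine3 (R : realType) (Th : mesh R 3) (E : {set vertex Th})
    (f : 'rV[R]_3 -> R) v0 v1 v2 t s : enum E = [:: v0; v1; v2] ->
  affine_on (chull (@pos R 3 Th) E) f -> 0 <= t -> 0 <= s -> t + s <= 1 ->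
  f (face_param E [:: t; s]) = f (pos v0) + (f (pos v1) - f (pos v0)) * t
    + (f (pos v2) - f (pos v0)) * s.
Proof.
move=> eE [a [c fE]] t0 s0 ts1.
have v0E : v0 \in E by rewrite -mem_enum eE !inE eqxx.
have v1E : v1 \in E by rewrite -mem_enum eE !inE eqxx orbT.
have v2E : v2 \in E by rewrite -mem_enum eE !inE eqxx !orbT.
have /and3P[n10 n20 n21] : [&& v1 != v0, v2 != v0 & v2 != v1].
  have := enum_uniq E; rewrite eE /= !inE negb_or andbT => /andP[/andP[? ?] ?].
  by apply/and3P; split; rewrite eq_sym.
rewrite (fE (pos v0)); last exact: chull_vertex.
rewrite (fE (pos v1)); last exact: chull_vertex.
rewrite (fE (pos v2)); last exact: chull_vertex.
rewrite fE /face_param /face_edge eE /= !big_ord_recl big_ord0 /= ?addr0.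
  by rewrite !(dotrDr, dotrZr, dotrNr); ring.
exists (fun v => if v == v0 then 1 - t - s else if v == v1 then t else s).
split=> [v _||].
- by do 2?case: ifP => _; lra.
- rewrite -big_enum eE !big_cons big_nil /= !eqxx.
  by rewrite (negbTE n10) (negbTE n20) (negbTE n21); ring.
- rewrite -big_enum eE !big_cons big_nil /= !eqxx.
  rewrite (negbTE n10) (negbTE n20) (negbTE n21).
  by apply/rowP => i; rewrite !mxE; ring.
Qed.

Lemma face_integral_affine (R : realType) (d : nat) (Th : mesh R d)
    (E : {set vertex Th}) (f : 'rV[R]_d -> R) :
  d = 2%N \/ d = 3%N -> #|E| = d -> affine_on (chull (@pos R d Th) E) f ->
  face_integral E f = face_area E * ((\sum_(v in E) f (pos v)) / d%:R).
Proof.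
move=> hd cE fE; case: hd => dE; subst d; rewrite /face_integral /face_area.
- have [v0 [v1 [eE _ _ _]]] := enum_card2 cE.
  rewrite (_ : (2.-1)`! = 1)%N // -mulrA; congr (_ * _); rewrite -big_enum eE !big_cons big_nil /=.
  apply: (etrans (etrans _ (Rintegral_cubic (f (pos v0)) (f (pos v1) - f (pos v0)) 0 0 ler01)));
    last by field.
  apply: eq_Rintegral => t; rewrite inE /= in_itv /= => t01.
  by rewrite (face_param_affine2 eE fE t01); ring.
- have [v0 [v1 [v2 [eE _ _ _ _]]]] := enum_card3 cE.
  rewrite (_ : (3.-1)`! = 2)%N // -mulrA; congr (_ * _); rewrite -big_enum eE !big_cons big_nil /=.
  set a := f (pos v0); set b := f (pos v1) - a; set c := f (pos v2) - a.
  (* The coefficients are those, in powers of [t], of the inner integral of [a + b t + c s] over [s]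
     in [[0, 1 - t]]. *)
  apply: (etrans (etrans _ (Rintegral_cubic (a + c / 2) (b - a - c) (c / 2 - b) 0 ler01)));
    last by rewrite /b /c; field.
  apply: eq_Rintegral => t; rewrite inE /= in_itv /= => /andP[t0 t1].
  have t1' : 0 <= 1 - t by lra.
  apply: (etrans (etrans _ (Rintegral_cubic (a + b * t) c 0 0 t1')));
    last by field.
  apply: eq_Rintegral => s; rewrite inE /= in_itv /= => /andP[s0 s1].
  rewrite (face_param_affine3 eE fE) //; last by lra.
  by rewrite -/a -/b -/c; ring.
Qed.

(** This is the quadratic form of the mass matrix of affine elements, with entries
    [face_area E * (1 + delta_ij) / (d (d+1))]. *)
Lemma face_integral_sqr (R : realType) (d : nat) (Th : mesh R d)
    (E : {set vertex Th}) (f : 'rV[R]_d -> R) :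
  d = 2%N \/ d = 3%N -> #|E| = d -> affine_on (chull (@pos R d Th) E) f ->
  face_integral E (fun x => f x ^+ 2) = face_area E *
    (((\sum_(v in E) f (pos v)) ^+ 2 + \sum_(v in E) f (pos v) ^+ 2)
     / (d%:R * d.+1%:R)).
Proof.
move=> hd cE fE; case: hd => dE; subst d; rewrite /face_integral /face_area.
- have [v0 [v1 [eE _ _ _]]] := enum_card2 cE.
  rewrite (_ : (2.-1)`! = 1)%N // -mulrA; congr (_ * _); rewrite -!big_enum eE !big_cons !big_nil /=.
  set a := f (pos v0); set b := f (pos v1) - a.
  apply: (etrans (etrans _ (Rintegral_cubic (a ^+ 2) (2 * a * b) (b ^+ 2) 0 ler01)));
    last by rewrite /b; field.
  apply: eq_Rintegral => t; rewrite inE /= in_itv /= => t01.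
  by rewrite (face_param_affine2 eE fE t01) -/a -/b; ring.
- have [v0 [v1 [v2 [eE _ _ _ _]]]] := enum_card3 cE.
  rewrite (_ : (3.-1)`! = 2)%N // -mulrA; congr (_ * _); rewrite -!big_enum eE !big_cons !big_nil /=.
  set a := f (pos v0); set b := f (pos v1) - a; set c := f (pos v2) - a.
  (* Again the expansion in [t] of the inner integral, now of [(a + b t + c s)^2]. *)
  apply: (etrans (etrans _ (Rintegral_cubic (a ^+ 2 + a * c + c ^+ 2 / 3)
    (2 * a * b - a ^+ 2 + b * c - 2 * a * c - c ^+ 2)
    (b ^+ 2 - 2 * a * b - 2 * b * c + a * c + c ^+ 2)
    (- b ^+ 2 + b * c - c ^+ 2 / 3) ler01)));
    last by rewrite /b /c; field.
  apply: eq_Rintegral => t; rewrite inE /= in_itv /= => /andP[t0 t1].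
  have t1' : 0 <= 1 - t by lra.
  apply: (etrans (etrans _ (Rintegral_cubic ((a + b * t) ^+ 2) (2 * (a + b * t) * c) (c ^+ 2) 0 t1')));
    last by field.
  apply: eq_Rintegral => s; rewrite inE /= in_itv /= => /andP[s0 s1].
  rewrite (face_param_affine3 eE fE) //; last by lra.
  by rewrite -/a -/b -/c; ring.
Qed.

(** * Two inequalities for finite sums *)

Lemma sqr_sum_le (R : realType) (I : finType) (A : {set I}) (x : I -> R) :
  (\sum_(i in A) x i) ^+ 2 <= #|A|%:R * \sum_(i in A) x i ^+ 2.
Proof.
have -> : #|A|%:R * \sum_(i in A) x i ^+ 2 =
    \sum_(i in A) \sum_(j in A) (x i ^+ 2 + x j ^+ 2) / 2.
  rewrite [RHS](eq_bigr (fun i => (#|A|%:R * x i ^+ 2 + \sum_(j in A) x j ^+ 2) / 2)).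
    by rewrite -mulr_suml big_split /= sumr_const -mulr_sumr -[X in (_ + X) / _]mulr_natl; field.
  by move=> i _; rewrite -mulr_suml big_split /= sumr_const -[X in (X + _) / _]mulr_natl.
rewrite expr2 big_distrlr /=; apply: ler_sum => i _; apply: ler_sum => j _.
by have := sqr_ge0 (x i - x j); rewrite sqrrB; lra.
Qed.

(** Double counting: [g k] occurs once for each path from some [i] through some [j] to [k]. There
    are at most [b] choices of [j] next to [k], then at most [a] choices of [i] next to [j]. It is
    meant for faces [i], [k] and cells [j]. *)
Lemma sum_sum_adjacent_le (R : realType) (I J : finType) (S : {set I})
    (C : {set J}) (r : I -> J -> bool) (g : I -> R) (a b : nat) :
  (forall i, i \in S -> 0 <= g i) ->
  (forall j, j \in C -> (#|[set i in S | r i j]%SET| <= a)%N) ->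
  (forall i, i \in S -> (#|[set j in C | r i j]%SET| <= b)%N) ->
  \sum_(i in S) \sum_(j in C | r i j) \sum_(k in S | r k j) g k <=
  (a * b)%:R * \sum_(i in S) g i.
Proof.
move=> g0 ha hb.
have cardE (K : finType) (A : {set K}) (P : pred K) (x : R) :
    \sum_(i in A | P i) x = #|[set i in A | P i]%SET|%:R * x.
  by rewrite sumr_const mulr_natl; congr (_ *+ _); apply: eq_card => i; rewrite inE.
rewrite (exchange_big_dep (mem C)) /=; last by move=> i j _ /andP[].
apply: (@le_trans _ _ (\sum_(j in C) a%:R * \sum_(k in S | r k j) g k)).
  apply: ler_sum => j jC; under eq_bigl do rewrite jC /=.
  rewrite cardE ler_wpM2r ?ler_nat ?ha //.
  by apply: sumr_ge0 => k /andP[/g0].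
rewrite -mulr_sumr natrM -mulrA ler_wpM2l //.
rewrite (exchange_big_dep (mem S)) /=; last by move=> i j _ /andP[].
rewrite mulr_sumr; apply: ler_sum => i iS; under eq_bigl do rewrite iS /=.
by rewrite cardE ler_wpM2r ?ler_nat ?hb ?g0.
Qed.

(** * Affine functions on a set *)

Section Affine.
Variables (R : realType) (d : nat).
Implicit Types (A : set 'rV[R]_d) (f g : 'rV[R]_d -> R).

Lemma affine_onS A B f : A `<=` B -> affine_on B f -> affine_on A f.
Proof. by move=> AB [a [c fE]]; exists a, c => x /AB /fE. Qed.

Lemma affine_on_comb A f g (a b c : R) : affine_on A f -> affine_on A g ->
  affine_on A (fun x => a * f x + b * g x + c).
Proof.
move=> [u [k fE]] [v [l gE]]; exists (a *: u + b *: v), (a * k + b * l + c) => x Ax.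
by rewrite fE // gE // dotrDl !dotrZl; ring.
Qed.

Lemma affine_trace (Th : mesh R d) z T : VDG Th z -> T \in cells Th ->
  affine_on (chull (@pos R d Th) T) (trace z T).
Proof.
by move=> hz /hz[a [c zE]]; exists a, c => x; exact: (affine_trace_lim zE).
Qed.

End Affine.

(** * Weighted norms on faces and shape regularity *)

Section FaceNorms.
Variables (R : realType) (d : nat) (hd : d = 2%N \/ d = 3%N) (sigma : R).
Variables (Th : mesh R d) (hs : shape_regular Th sigma).
Implicit Types (E T : {set vertex Th}) (f : 'rV[R]_d -> R).

Let d_gt0 : (0 < d)%N. Proof. by case: hd => ->. Qed.

Definition face_weight E : R := face_area E / face_diam E.

(** No sign of [sigma] is assumed. A cell has two distinct vertices, so its diameter is positive,
    and so is [sigma] times the nonnegative inradius. *)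
Lemma shape_regular_gt0 T : T \in cells Th ->
  0 < sigma /\ 0 < inradius (chull (@pos R d Th) T).
Proof.
move=> Tc; have [cT iT] := cells_simplex Tc.
have /card_gt1P[v [w [vT wT vw]]] : (1 < #|T|)%N by rewrite cT ltnS.
have /andP[r0 _] := inradius_le_edge iT vT wT vw.
have h0 : 0 < diam (chull (@pos R d Th) T).
  apply: (@lt_le_trans _ _ (enorm (pos v - pos w))); last first.
    by apply: enorm_le_diam; exact: chull_vertex.
  by rewrite enorm_gt0 subr_eq0; apply: contra vw => /eqP/pos_inj ->.
have sr := lt_le_trans h0 (hs Tc).
have r1 : 0 < inradius (chull (@pos R d Th) T).
  rewrite lt_def r0 andbT; apply/eqP => r00.
  by move: sr; rewrite r00 mulr0 ltxx.
by rewrite -(pmulr_lgt0 _ r1).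
Qed.

Lemma face_diam_gt0 T E : T \in cells Th -> E \subset T -> #|E| = d ->
  0 < face_diam E.
Proof.
move=> Tc sET cE; have [cT iT] := cells_simplex Tc.
have /card_gt1P[v [w [vE wE vw]]] : (1 < #|E|)%N by rewrite cE; case: hd => ->.
apply: (@lt_le_trans _ _ (enorm (pos v - pos w))); last first.
  by apply: enorm_le_diam; exact: chull_vertex.
by rewrite enorm_gt0 subr_eq0; apply: contra vw => /eqP/pos_inj ->.
Qed.

Lemma face_area_gt0 T E : T \in cells Th -> E \subset T -> #|E| = d ->
  0 < face_area E.
Proof.
move=> Tc sET cE; have [_ r0] := shape_regular_gt0 Tc.
have /andP[lo _] := sqrt_det_gram_bounds hd Tc sET cE.
by rewrite divr_gt0 ?ltr0n ?fact_gt0 // (lt_le_trans _ lo) ?exprn_gt0.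
Qed.

Lemma face_weight_ge0 T E : T \in cells Th -> E \subset T -> #|E| = d ->
  0 <= face_weight E.
Proof.
move=> Tc sET cE.
by rewrite divr_ge0 ?ltW ?(face_area_gt0 Tc sET cE) ?(face_diam_gt0 Tc sET cE).
Qed.

Lemma face_weight_le T E E' : T \in cells Th -> E \subset T -> E' \subset T ->
  #|E| = d -> #|E'| = d ->
  face_weight E <= (1 + `|sigma| ^+ d.-1) * face_weight E'.
Proof.
move=> Tc sET sE'T cE cE'.
have [s0 r0] := shape_regular_gt0 Tc.
have h0 := face_diam_gt0 Tc sET cE; have h0' := face_diam_gt0 Tc sE'T cE'.
have /andP[_ up] := sqrt_det_gram_bounds hd Tc sET cE.
have /andP[lo _] := sqrt_det_gram_bounds hd Tc sE'T cE'.
have le_h E1 : E1 \subset T -> #|E1| = d -> face_diam E1 <=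
    sigma * inradius (chull (@pos R d Th) T).
  move=> sE1 cE1; apply: le_trans (hs Tc).
  have /card_gt0P[v vE1] : (0 < #|E1|)%N by rewrite cE1.
  exact: le_diam vE1 sE1.
have hE := le_h E sET cE; have hE' := le_h E' sE'T cE'.
(* The proof yields the factor [sigma ^+ d.-1]. The larger constant in the statement is at least 1
   for every real [sigma], as is needed for a [rho] fixed before any mesh is given. *)
apply: (@le_trans _ _ (sigma ^+ d.-1 * face_weight E')); last first.
  rewrite ler_wpM2r ?(face_weight_ge0 Tc) // gtr0_norm //; lra.
(* Since [d - 1] is positive, one power of the diameter in the upper bound on the area of E cancels
   the division by it, leaving the power [n]. *)
have [n dn] : exists n, d.-1 = n.+1 by case: hd => ->; [exists 0%N | exists 1%N].
rewrite /face_weight /face_area mulrAC [X in _ <= _ * X]mulrAC mulrA.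
rewrite ler_wpM2r ?invr_ge0 //.
move: up lo; set s := Num.sqrt _; set s' := Num.sqrt _.
rewrite dn /=; set h := face_diam E in h0 hE *; set h' := face_diam E' in h0' hE' *.
set r := inradius _ in r0 hE hE' *; move=> up lo.
apply: (@le_trans _ _ ((sigma * r) ^+ n)).
  rewrite ler_pdivrMr //; apply: le_trans up _; rewrite exprSr ler_wpM2r ?(ltW h0) //.
  by apply: lerXn2r; rewrite ?nnegrE ?(ltW h0) ?(ltW (mulr_gt0 s0 r0)).
rewrite mulrA ler_pdivlMr //.
apply: (@le_trans _ _ ((sigma * r) ^+ n.+1)).
  by rewrite exprSr ler_wpM2l // exprn_ge0 ?ltW ?mulr_gt0.
by rewrite exprMn ler_wpM2l ?exprn_ge0 ?(ltW s0).
Qed.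

Lemma P0_affine T E f : T \in cells Th -> E \subset T -> #|E| = d ->
  affine_on (chull (@pos R d Th) E) f ->
  P0 E f = (\sum_(v in E) f (pos v)) / d%:R.
Proof.
move=> Tc sET cE fE; have a0 := face_area_gt0 Tc sET cE.
rewrite /P0 (face_integral_affine hd cE fE).
rewrite (face_integral_affine hd cE (f := fun=> 1)); last first.
  by exists 0, 1 => x _; rewrite dotrC dotr0r add0r.
rewrite sumr_const cE divff ?pnatr_eq0 -?lt0n // mulr1 mulKf //.
by rewrite gt_eqF.
Qed.

Lemma L2norm_affine T E f : T \in cells Th -> E \subset T -> #|E| = d ->
  affine_on (chull (@pos R d Th) E) f ->
  L2norm E (fun x => (Num.sqrt (face_diam E))^-1 * f x) ^+ 2 =
  face_weight E *
    (((\sum_(v in E) f (pos v)) ^+ 2 + \sum_(v in E) f (pos v) ^+ 2)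
     / (d%:R * d.+1%:R)).
Proof.
move=> Tc sET cE fE; have a0 := face_area_gt0 Tc sET cE.
have h0 := face_diam_gt0 Tc sET cE.
set k := _^-1; have k2 : k ^+ 2 = (face_diam E)^-1.
  by rewrite exprVn sqr_sqrtr // ltW.
have gE : affine_on (chull (@pos R d Th) E) (fun x => k * f x).
  have := affine_on_comb k 0 0 fE fE.
  by congr affine_on; apply/funext => x; ring.
rewrite /L2norm (face_integral_sqr hd cE gE) sqr_sqrtr; last first.
  by rewrite mulr_ge0 ?(ltW a0) // divr_ge0 ?mulr_ge0 // addr_ge0 ?sqr_ge0 ?sumr_ge0
    // => v _; exact: sqr_ge0.
rewrite -mulr_sumr [X in _ + X](eq_bigr (fun v => k ^+ 2 * f (pos v) ^+ 2));
  last by move=> v _; rewrite exprMn.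
by rewrite -mulr_sumr exprMn k2 /face_weight; ring.
Qed.

(** Proved as an identity in the vertex sums u of [f] and q of its square: subtracting [m = u / d]
    turns u into 0 and q into [q - 2 m u + d m^2]. *)
Lemma L2norm_sub_P0 T E f : T \in cells Th -> E \subset T -> #|E| = d ->
  affine_on (chull (@pos R d Th) E) f ->
  L2norm E (fun x => (Num.sqrt (face_diam E))^-1 * (f x - P0 E f)) ^+ 2 =
  L2norm E (fun x => (Num.sqrt (face_diam E))^-1 * f x) ^+ 2
  - face_weight E * ((\sum_(v in E) f (pos v)) / d%:R) ^+ 2.
Proof.
move=> Tc sET cE fE; set m := P0 E f.
have gE : affine_on (chull (@pos R d Th) E) (fun x => f x - m).
  have := affine_on_comb 1 0 (- m) fE fE.
  by congr affine_on; apply/funext => x; ring.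
rewrite (L2norm_affine Tc sET cE fE) (L2norm_affine Tc sET cE gE).
have -> : \sum_(v in E) (f (pos v) - m) ^+ 2 = \sum_(v in E) f (pos v) ^+ 2
    - 2 * m * (\sum_(v in E) f (pos v)) + d%:R * m ^+ 2.
  rewrite (eq_bigr (fun v => f (pos v) ^+ 2 + - (2 * m) * f (pos v) + m ^+ 2)).
    by rewrite !big_split /= -mulr_sumr sumr_const cE -[X in _ + X]mulr_natl; ring.
  by move=> v _; ring.
rewrite sumrB sumr_const cE -[X in _ - X]mulr_natl /m (P0_affine Tc sET cE fE).
rewrite -natr1; set u := \sum_(v in E) f (pos v); set q := \sum_(v in E) _.
have dn : d%:R != 0 :> R by rewrite pnatr_eq0 -lt0n.
have dn1 : d%:R + 1 != 0 :> R by rewrite natr1 pnatr_eq0.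
by field; rewrite dn addrC dn1.
Qed.

End FaceNorms.

(** * Bounding the jump energy by the energy of the mean jumps *)

Section JumpEstimate.
Variables (R : realType) (d : nat) (hd : d = 2%N \/ d = 3%N) (sigma : R).
Variables (Th : mesh R d) (hs : shape_regular Th sigma).
Variables (nu : {set vertex Th} -> 'rV[R]_d) (GammaD GammaN : set 'rV[R]_d).
Hypothesis hDN : forall E, E \in boundary_faces Th ->
  (E \in faces_on Th GammaN) = (E \notin faces_on Th GammaD).
Hypothesis hnu : forall E, E \in interior_faces Th -> unit_normal E (nu E).
Variables (z : 'rV[R]_d -> R) (hz : Zspace nu GammaN z).
Implicit Types (E T : {set vertex Th}).

Let d_gt0 : (0 < d)%N. Proof. by case: hd => ->. Qed.
Let hV : VDG Th z. Proof. by case: hz. Qed.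
Let dR_neq0 : d%:R != 0 :> R. Proof. by rewrite pnatr_eq0 -lt0n. Qed.

Let S := interior_faces Th :|: faces_on Th GammaD.
Let trace_mean E T : R := (\sum_(v in E) trace z T (pos v)) / d%:R.
Let jump_mean E : R := (\sum_(v in E) jump nu z E (pos v)) / d%:R.
(** The face of T opposite to the vertex [w] is [T :\ w], so this sums the squared Crouzeix-Raviart
    degrees of freedom of the trace. *)
Let cell_means T : R := \sum_(w in T) trace_mean (T :\ w) T ^+ 2.

Lemma mem_neighbors E T :
  (T \in neighbors E) = (T \in cells Th) && (E \subset T).
Proof. by rewrite inE. Qed.

Lemma face_cases E T : T \in cells Th -> E \subset T -> #|E| = d ->
  E \in interior_faces Th \/ E \in boundary_faces Th.
Proof.
move=> Tc sET cE; rewrite !inE cE eqxx /=.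
have : (0 < #|neighbors E|)%N by apply/card_gt0P; exists T; rewrite mem_neighbors Tc.
by rewrite leq_eqVlt => /orP[/eqP <-|->]; [right | left].
Qed.

Lemma boundary_notin_interior E : E \in boundary_faces Th ->
  (E \in interior_faces Th) = false.
Proof. by rewrite !inE => /andP[_ /eqP ->]; rewrite ltnn andbF. Qed.

Lemma jump_face_cell E : E \in S -> exists2 T, T \in neighbors E & #|E| = d.
Proof.
rewrite finset.in_setU => /orP[Ei|]; last rewrite inE => /andP[Eb _].
  have [pn _ _] := neighbors_interior d_gt0 Ei (hnu Ei).
  by exists (cell_plus nu E) => //; move: Ei; rewrite inE => /andP[/eqP].
exists (cell_bnd E); first by rewrite neighbors_boundary // finset.set11.
by move: Eb; rewrite inE => /andP[/eqP].
Qed.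

Lemma affine_trace_face E T : T \in neighbors E ->
  affine_on (chull (@pos R d Th) E) (trace z T).
Proof.
rewrite mem_neighbors => /andP[Tc sET].
exact: affine_onS (chullS sET) (affine_trace hV Tc).
Qed.

Lemma affine_jump E : E \in S -> affine_on (chull (@pos R d Th) E) (jump nu z E).
Proof.
rewrite finset.in_setU => /orP[Ei|]; last rewrite inE => /andP[Eb _].
  have [pn mn _] := neighbors_interior d_gt0 Ei (hnu Ei).
  have := affine_on_comb 1 (-1) 0 (affine_trace_face pn) (affine_trace_face mn).
  by congr affine_on; apply/funext => x; rewrite /jump Ei; ring.
have bn : cell_bnd E \in neighbors E by rewrite neighbors_boundary // finset.set11.
have := affine_trace_face bn.
by congr affine_on; apply/funext => x; rewrite /jump boundary_notin_interior.
Qed.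

(** A face of a cell outside [S] is a Neumann face, where the mean vanishes. The value 0 there is
    what lets later sums over all faces of a cell shrink to faces in [S]. *)
Lemma trace_mean_sqr_le E T : T \in neighbors E -> #|E| = d ->
  trace_mean E T ^+ 2 <= if E \in S then jump_mean E ^+ 2 else 0.
Proof.
move=> Tn cE; have := Tn; rewrite mem_neighbors => /andP[Tc sET].
have [Ei|Eb] := face_cases Tc sET cE.
  have [pn mn /fintype.subsetP/(_ T Tn)] := neighbors_interior d_gt0 Ei (hnu Ei).
  have ES : E \in S by rewrite finset.in_setU Ei.
  rewrite ES.
  have jE : jump_mean E =
      trace_mean E (cell_plus nu E) - trace_mean E (cell_minus nu E).
    by rewrite /jump_mean /jump Ei sumrB mulrBl.
  have : trace_mean E (cell_plus nu E) + trace_mean E (cell_minus nu E) = 0.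
    have [_ /(_ E)] := hz; rewrite finset.in_setU Ei => /(_ isT).
    rewrite (P0_affine hd hs Tc sET cE); last first.
      have := affine_on_comb 2^-1 2^-1 0 (affine_trace_face pn)
        (affine_trace_face mn).
      by congr affine_on; apply/funext => x; rewrite /average Ei; ring.
    rewrite /average Ei -mulr_suml big_split /= /trace_mean => h.
    by rewrite -mulrDl; lra.
  set p := trace_mean E (cell_plus nu E) in jE *.
  set m := trace_mean E (cell_minus nu E) in jE *.
  (* The two one-sided means are opposite, so the mean jump is [2 * p]. *)
  move=> pm0 Tpm; have mE : m = - p by lra.
  have -> : trace_mean E T ^+ 2 = p ^+ 2.
    move: Tpm; rewrite !inE => /orP[] /eqP -> //.
    by rewrite -/m mE sqrrN.
  by rewrite jE mE; have := sqr_ge0 p; lra.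
have bnd := neighbors_boundary Eb.
have Tb : T = cell_bnd E by move: Tn; rewrite bnd inE => /eqP.
have nEi := boundary_notin_interior Eb.
case: ifPn => [ES|]; last first.
  rewrite finset.in_setU nEi /= => ED; have [_ /(_ E)] := hz.
  rewrite finset.in_setU (hDN Eb) ED orbT => /(_ isT).
  have -> : average nu z E = trace z T.
    by apply/funext => x; rewrite /average nEi Tb.
  rewrite (P0_affine hd hs Tc sET cE); last exact: affine_trace_face.
  by rewrite -/(trace_mean E T) => ->; rewrite expr0n.
have -> // : trace_mean E T = jump_mean E.
by congr (_ / _); apply: eq_bigr => v _; rewrite /jump nEi -Tb.
Qed.

(* Summing the face means d m_w = sum_(v in T) z_v - z_w over w recovers the
   nodal values: z_v = sum_w m_w - d m_v (Crouzeix-Raviart). *)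
Lemma nodal_value_le T v : T \in cells Th -> v \in T ->
  trace z T (pos v) ^+ 2 <= (2 * d.+1%:R + 2 * d%:R ^+ 2) * cell_means T.
Proof.
move=> Tc vT; have [cT _] := cells_simplex Tc.
set s := \sum_(w in T) trace z T (pos w).
have mE w : w \in T -> trace_mean (T :\ w) T = (s - trace z T (pos w)) / d%:R.
  move=> wT; rewrite /trace_mean /s.
  by congr (_ / _); rewrite [X in X - _](big_setD1 w wT) /= [RHS]addrC addKr.
have sE : \sum_(w in T) trace_mean (T :\ w) T = s.
  rewrite (eq_bigr (fun w => (s - trace z T (pos w)) / d%:R)) //.
  rewrite -mulr_suml sumrB sumr_const cT -/s -[X in (X - _) / _]mulr_natl -natr1.
  by field.
have -> : trace z T (pos v) = s - d%:R * trace_mean (T :\ v) T.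
  by rewrite mE //; field.
have h1 : s ^+ 2 <= d.+1%:R * cell_means T.
  by rewrite -{1}sE -cT; exact: sqr_sum_le.
have h2 : trace_mean (T :\ v) T ^+ 2 <= cell_means T.
  rewrite /cell_means (bigD1 v) //= lerDl; apply: sumr_ge0 => w _.
  exact: sqr_ge0.
set m := trace_mean _ _ in h2 *; set M := cell_means T in h1 h2 *.
have h3 : (d%:R * m) ^+ 2 <= d%:R ^+ 2 * M.
  by rewrite exprMn ler_wpM2l ?sqr_ge0.
(* This is [(s - d m)^2 <= 2 s^2 + 2 (d m)^2], the source of the constant. *)
by have := sqr_ge0 (s + d%:R * m); rewrite sqrrD sqrrB; lra.
Qed.

Lemma cell_means_ge0 T : 0 <= cell_means T.
Proof. by apply: sumr_ge0 => w _; exact: sqr_ge0. Qed.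

Lemma jump_nodal_value_le E v : E \in S -> v \in E ->
  jump nu z E (pos v) ^+ 2 <= 4 * (2 * d.+1%:R + 2 * d%:R ^+ 2) *
    \sum_(T in neighbors E) cell_means T.
Proof.
move=> ES vE; set C := 2 * _ + _.
have C0 : 0 <= C by rewrite addr_ge0 ?mulr_ge0 ?sqr_ge0.
have le_nb T : T \in neighbors E -> trace z T (pos v) ^+ 2 <=
    C * \sum_(T in neighbors E) cell_means T.
  move=> Tn; have := Tn; rewrite mem_neighbors => /andP[Tc /fintype.subsetP sET].
  apply: le_trans (nodal_value_le Tc (sET _ vE)) _; rewrite ler_wpM2l //.
  rewrite (bigD1 T) //= lerDl; apply: sumr_ge0 => T' _; exact: cell_means_ge0.
rewrite -mulrA; set B := C * _ in le_nb *.
move: ES; rewrite finset.in_setU => /orP[Ei|]; last rewrite inE => /andP[Eb _].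
  have [/le_nb hp /le_nb hm _] := neighbors_interior d_gt0 Ei (hnu Ei).
  rewrite /jump Ei; move: hp hm; set p := trace _ _ _; set m := trace _ _ _.
  (* The factor 4 comes from [(p - m)^2 <= 2 p^2 + 2 m^2], with both squares at most [B]. *)
  by move=> hp hm; have := sqr_ge0 (p + m); rewrite sqrrD sqrrB; lra.
have bn : cell_bnd E \in neighbors E by rewrite neighbors_boundary // finset.set11.
rewrite /jump boundary_notin_interior //; have := le_nb _ bn.
by have := sqr_ge0 (trace z (cell_bnd E) (pos v)); lra.
Qed.

Let jump_energy E :=
  L2norm E (fun x => (Num.sqrt (face_diam E))^-1 * jump nu z E x) ^+ 2.
Let mean_energy E := face_weight E * jump_mean E ^+ 2.

Lemma mean_energy_ge0 E : E \in S -> 0 <= mean_energy E.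
Proof.
move=> /jump_face_cell[T]; rewrite mem_neighbors => /andP[Tc sET] cE.
by rewrite mulr_ge0 ?sqr_ge0 ?(face_weight_ge0 hd hs Tc sET cE).
Qed.

Lemma jump_energy_le E : E \in S ->
  jump_energy E <= 4 * (2 * d.+1%:R + 2 * d%:R ^+ 2) *
    \sum_(T in neighbors E) face_weight E * cell_means T.
Proof.
move=> ES; have [T] := jump_face_cell ES.
rewrite mem_neighbors => /andP[Tc sET] cE.
rewrite /jump_energy (L2norm_affine hd hs Tc sET cE (affine_jump ES)).
rewrite -mulr_sumr [leRHS]mulrCA ler_wpM2l ?(face_weight_ge0 hd hs Tc sET cE) //.
set B := _ * \sum_(T0 in _) _.
have le_q : \sum_(v in E) jump nu z E (pos v) ^+ 2 <= d%:R * B.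
  rewrite -[X in X%:R * B]cE mulr_natl -sumr_const; apply: ler_sum => v vE.
  exact: jump_nodal_value_le.
have := sqr_sum_le E (fun v => jump nu z E (pos v)); rewrite cE => le_s.
set q := \sum_(v in E) _ ^+ 2 in le_q le_s *.
(* By Cauchy-Schwarz the numerator is at most [(d+1) q <= (d+1) d B], which cancels the quadrature
   denominator. *)
rewrite ler_pdivrMr ?mulr_gt0 ?ltr0n // -natr1.
have : d%:R * q <= d%:R * (d%:R * B) by rewrite ler_wpM2l.
by lra.
Qed.

(** In each term the weight of E is exchanged for that of the face [T :\ w] carrying the mean, at
    the cost of the shape-regularity factor. *)
Lemma weight_cell_means_le E T : T \in neighbors E -> #|E| = d ->
  face_weight E * cell_means T <= (1 + `|sigma| ^+ d.-1) *
    \sum_(E' in S | E' \subset T) mean_energy E'.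
Proof.
rewrite mem_neighbors => /andP[Tc sET] cE; have [cT _] := cells_simplex Tc.
set K := 1 + _; have K0 : 0 <= K by rewrite addr_ge0 ?exprn_ge0.
pose g E' := if E' \in S then mean_energy E' else 0.
have g0 E' : 0 <= g E' by rewrite /g; case: ifP => // /mean_energy_ge0.
have injT : {in T &, injective (fun w => T :\ w)}.
  move=> w w' wT w'T /finset.setP/(_ w); rewrite !inE eqxx wT /= andbT.
  by move=> /esym/negbFE/eqP.
apply: (@le_trans _ _ (K * \sum_(w in T) g (T :\ w))).
  rewrite mulr_sumr mulr_sumr; apply: ler_sum => w wT.
  have sw : T :\ w \subset T by exact: finset.subD1set.
  have cw : #|T :\ w| = d by move: cT; rewrite (cardsD1 w) wT => -[].
  have wn : T \in neighbors (T :\ w) by rewrite mem_neighbors Tc.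
  apply: (@le_trans _ _ (K * face_weight (T :\ w) * trace_mean (T :\ w) T ^+ 2)).
    rewrite ler_wpM2r ?sqr_ge0 //; exact: (face_weight_le hd hs Tc).
  rewrite -mulrA ler_wpM2l //.
  apply: le_trans (ler_wpM2l _ (trace_mean_sqr_le wn cw)) _.
    exact: (face_weight_ge0 hd hs Tc).
  by rewrite /g /mean_energy; case: ifP; rewrite ?mulr0.
(* Distinct vertices have distinct opposite faces, so the sum over [w] becomes a sum over faces of
   T, with [g] vanishing outside [S]. *)
rewrite ler_wpM2l // -(big_imset g injT) /=.
rewrite [leRHS]big_mkcond [leLHS]big_mkcond /=; apply: ler_sum => E' _.
case: ifP => [/imsetP[w wT ->]|_].
  by rewrite finset.subD1set andbT /g.
by case: ifP => // /andP[/mean_energy_ge0].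
Qed.

Lemma jump_energy_sum_le :
  \sum_(E in S) jump_energy E <=
  4 * (2 * d.+1%:R + 2 * d%:R ^+ 2) * (1 + `|sigma| ^+ d.-1) *
    (d.+1 * 2)%:R * \sum_(E in S) mean_energy E.
Proof.
set C := 4 * _; set K := 1 + _.
have C0 : 0 <= C by rewrite mulr_ge0 ?addr_ge0 ?mulr_ge0 ?sqr_ge0.
have K0 : 0 <= K by rewrite addr_ge0 ?exprn_ge0.
apply: (@le_trans _ _ (\sum_(E in S) C * (K * \sum_(T in cells Th | E \subset T)
    \sum_(E' in S | E' \subset T) mean_energy E'))).
  apply: ler_sum => E ES; apply: le_trans (jump_energy_le ES) _.
  have [_ _ cE] := jump_face_cell ES.
  rewrite ler_wpM2l // mulr_sumr (eq_bigl _ _ (mem_neighbors E)).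
  apply: ler_sum => T TE; apply: weight_cell_means_le => //.
  by rewrite mem_neighbors.
rewrite -mulr_sumr -mulr_sumr -(mulrA (C * K)) -(mulrA C K); do 2!apply: ler_wpM2l => //.
(* A cell has at most [d + 1] faces, one opposite to each vertex, and a face has at most two
   neighbors. *)
apply: sum_sum_adjacent_le => [E|T Tc|E ES]; first exact: mean_energy_ge0.
  have [cT _] := cells_simplex Tc; rewrite -cT.
  apply: leq_trans (leq_imset_card (fun w => T :\ w) (mem T)).
  apply/subset_leq_card/fintype.subsetP => E; rewrite inE => /andP[ES sET].
  have [_ _ cE] := jump_face_cell ES.
  have [v vE TE] := face_opposite Tc sET cE.
  by apply/imsetP; exists v; rewrite TE ?finset.setU1K // finset.setU11.
have -> : [set T in cells Th | E \subset T]%SET = neighbors E by [].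
move: ES; rewrite finset.in_setU => /orP[Ei|]; last rewrite inE => /andP[Eb _].
  have [_ _ /subset_leq_card] := neighbors_interior d_gt0 Ei (hnu Ei).
  by move/leq_trans; apply; rewrite cards2; case: (_ != _).
by rewrite neighbors_boundary // cards1.
Qed.

Lemma jump_energy_sub_P0 E : E \in S ->
  L2norm E (fun x => (Num.sqrt (face_diam E))^-1 *
    (jump nu z E x - P0 E (jump nu z E))) ^+ 2 = jump_energy E - mean_energy E.
Proof.
move=> ES; have [T] := jump_face_cell ES.
rewrite mem_neighbors => /andP[Tc sET] cE.
exact: (L2norm_sub_P0 hd hs Tc sET cE (affine_jump ES)).
Qed.

End JumpEstimate.

Theorem proposition3p4 (R : realType) (d : nat) (hd : d = 2%N \/ d = 3%N)
    (sigma : R) :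
  exists rho : R, 1 <= rho /\
  forall (Omega GammaD GammaN : set 'rV[R]_d) (Th : mesh R d)
         (nu : {set vertex Th} -> 'rV[R]_d),
    polyhedral Omega ->
    frontier Omega = GammaD `|` GammaN ->
    mesh_of Th Omega ->
    shape_regular Th sigma ->
    (forall E, E \in boundary_faces Th ->
       (E \in faces_on Th GammaN) = (E \notin faces_on Th GammaD)) ->
    (forall E, E \in interior_faces Th -> unit_normal E (nu E)) ->
    forall z, Zspace nu GammaN z ->
      \sum_(E in interior_faces Th :|: faces_on Th GammaD)
        L2norm E (fun x => (Num.sqrt (face_diam E))^-1 *
                   (jump nu z E x - P0 E (jump nu z E))) ^+ 2
      <= (1 - rho^-1) *
      \sum_(E in interior_faces Th :|: faces_on Th GammaD)
        L2norm E (fun x => (Num.sqrt (face_diam E))^-1 * jump nu z E x) ^+ 2.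
Proof.
(* The factors come, in order, from bounding jumps by face means, from comparing weights within a
   cell, and from counting paths face-cell-face. *)
pose rho : R := 4 * (2 * d.+1%:R + 2 * d%:R ^+ 2) * (1 + `|sigma| ^+ d.-1) *
    (d.+1 * 2)%:R.
have rho1 : 1 <= rho.
  have n1 n : (0 < n)%N -> 1 <= n%:R :> R by rewrite ler1n.
  rewrite /rho !mulr_ege1 ?n1 ?ler1n //; last by rewrite lerDl exprn_ge0.
  have := n1 d.+1 isT; have := sqr_ge0 (d%:R : R); lra.
exists rho; split=> // Omega GammaD GammaN Th nu _ _ _ hs hDN hnu z hz.
rewrite (eq_bigr _ (jump_energy_sub_P0 hd hs hnu hz)) sumrB.
have := jump_energy_sum_le hd hs hDN hnu hz; rewrite -/rho.
set B := \sum_(E in _) _; set M := \sum_(E in _) _ => leBM.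
(* With [B <= rho * M], the left side [B - M] is at most [B - B / rho]. *)
have : rho^-1 * B <= M by rewrite mulrC ler_pdivrMr ?(lt_le_trans ltr01) // mulrC.
lra.
Qed.
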